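(* Let $\mathbf{G3X}$ be any one of the calculi $\mathbf{G3E}$, $\mathbf{G3EN}$, $\mathbf{G3M}$, $\mathbf{G3MN}$, $\mathbf{G3C}$, $\mathbf{G3CN}$, $\mathbf{G3R}$, $\mathbf{G3K}$, $\mathbf{G3ED^\bot}$, $\mathbf{G3END^\bot}$, $\mathbf{G3ED^\Diamond}$, $\mathbf{G3ED}$, $\mathbf{G3END}$, $\mathbf{G3MD^\bot}$, $\mathbf{G3MND^\bot}$, $\mathbf{G3MD}$, $\mathbf{G3MND}$, $\mathbf{G3CD^\Diamond}$, $\mathbf{G3CD}$, $\mathbf{G3CND}$, $\mathbf{G3RD}$, $\mathbf{G3KD}$. The contraction rules $LC$: from $A,A,\Gamma\Rightarrow\Delta$ infer $A,\Gamma\Rightarrow\Delta$, and $RC$: from $\Gamma\Rightarrow\Delta,A,A$ infer $\Gamma\Rightarrow\Delta,A$, are height-preserving admissible in $\mathbf{G3X}$: if the premiss has a derivation of height $h$ in $\mathbf{G3X}$ then the conclusion has a derivation in $\mathbf{G3X}$ of height at most $h$.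
   Context: Formulas are generated from countably many propositional variables $p_0,p_1,\dots$ and the $0$-ary constant $\bot$ by the binary connectives $\wedge,\vee,\supset$ and the unary operator $\Box$; $\neg A:=A\supset\bot$, $\top:=\bot\supset\bot$, $\Diamond A:=\neg\Box\neg A$. A sequent is an expression $\Gamma\Rightarrow\Delta$ with $\Gamma,\Delta$ finite, possibly empty, multisets of formulas; if $\Pi=A_1,\dots,A_m$ then $\Box\Pi=\Box A_1,\dots,\Box A_m$. The calculus $\mathbf{G3cp}$ has initial sequents $p,\Gamma\Rightarrow\Delta,p$ ($p$ a propositional variable), the zero-premiss rule $L\bot$ with conclusion $\bot,\Gamma\Rightarrow\Delta$, and the rules (premisses / conclusion): $L\wedge$: $A,B,\Gamma\Rightarrow\Delta$ / $A\wedge B,\Gamma\Rightarrow\Delta$; $R\wedge$: $\Gamma\Rightarrow\Delta,A$ and $\Gamma\Rightarrow\Delta,B$ / $\Gamma\Rightarrow\Delta,A\wedge B$; $L\vee$: $A,\Gamma\Rightarrow\Delta$ and $B,\Gamma\Rightarrow\Delta$ / $A\vee B,\Gamma\Rightarrow\Delta$; $R\vee$: $\Gamma\Rightarrow\Delta,A,B$ / $\Gamma\Rightarrow\Delta,A\vee B$; $L\supset$: $\Gamma\Rightarrow\Delta,A$ and $B,\Gamma\Rightarrow\Delta$ / $A\supset B,\Gamma\Rightarrow\Delta$; $R\supset$: $A,\Gamma\Rightarrow\Delta,B$ / $\Gamma\Rightarrow\Delta,A\supset B$. Modal and deontic rules ($\Gamma,\Delta$ arbitrary multisets): $LR$-$E$: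 $A\Rightarrow B$ and $B\Rightarrow A$ / $\Box A,\Gamma\Rightarrow\Delta,\Box B$; $LR$-$M$: $A\Rightarrow B$ / $\Box A,\Gamma\Rightarrow\Delta,\Box B$; $LR$-$R$: $A,\Pi\Rightarrow B$ / $\Box A,\Box\Pi,\Gamma\Rightarrow\Delta,\Box B$; $LR$-$C$ (for each $n\ge1$): $A_1,\dots,A_n\Rightarrow B$ and $B\Rightarrow A_1$, …, $B\Rightarrow A_n$ / $\Box A_1,\dots,\Box A_n,\Gamma\Rightarrow\Delta,\Box B$; $LR$-$K$: $\Pi\Rightarrow B$ / $\Box\Pi,\Gamma\Rightarrow\Delta,\Box B$; $R$-$N$: $\Rightarrow B$ / $\Gamma\Rightarrow\Delta,\Box B$; $L$-$D^\bot$: $A\Rightarrow$ / $\Box A,\Gamma\Rightarrow\Delta$; $L$-$D^{\Diamond_E}$ ($|\Pi|\le2$): $\Pi\Rightarrow$ and $\Rightarrow\Pi$ / $\Box\Pi,\Gamma\Rightarrow\Delta$; $L$-$D^{\Diamond_M}$ ($|\Pi|\le2$): $\Pi\Rightarrow$ / $\Box\Pi,\Gamma\Rightarrow\Delta$; $L$-$D^{\Diamond_C}$: $\Pi,\Sigma\Rightarrow$ and $\Rightarrow A,B$ for every $A\in\Pi$, $B\in\Sigma$ / $\Box\Pi,\Box\Sigma,\Gamma\Rightarrow\Delta$; $L$-$D^*$: $\Pi\Rightarrow$ / $\Box\Pi,\Gamma\Rightarrow\Delta$. Each calculus is $\mathbf{G3cp}$ plus: $\mathbf{G3E}$: $LR$-$E$;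 $\mathbf{G3EN}$: $LR$-$E$, $R$-$N$; $\mathbf{G3M}$: $LR$-$M$; $\mathbf{G3MN}$: $LR$-$M$, $R$-$N$; $\mathbf{G3C}$: $LR$-$C$; $\mathbf{G3CN}$: $LR$-$C$, $R$-$N$; $\mathbf{G3R}$: $LR$-$R$; $\mathbf{G3K}$: $LR$-$K$; $\mathbf{G3ED^\bot}$ / $\mathbf{G3END^\bot}$: rules of $\mathbf{G3E}$ / $\mathbf{G3EN}$ plus $L$-$D^\bot$; $\mathbf{G3ED^\Diamond}$: rules of $\mathbf{G3E}$ plus $L$-$D^{\Diamond_E}$; $\mathbf{G3ED}$ / $\mathbf{G3END}$: rules of $\mathbf{G3E}$ / $\mathbf{G3EN}$ plus $L$-$D^\bot$ and $L$-$D^{\Diamond_E}$; $\mathbf{G3MD^\bot}$ / $\mathbf{G3MND^\bot}$: rules of $\mathbf{G3M}$ / $\mathbf{G3MN}$ plus $L$-$D^\bot$; $\mathbf{G3MD}$ / $\mathbf{G3MND}$: rules of $\mathbf{G3M}$ / $\mathbf{G3MN}$ plus $L$-$D^{\Diamond_M}$; $\mathbf{G3CD^\Diamond}$: rules of $\mathbf{G3C}$ plus $L$-$D^{\Diamond_C}$; $\mathbf{G3CD}$, $\mathbf{G3CND}$, $\mathbf{G3RD}$, $\mathbf{G3KD}$: rules of $\mathbf{G3C}$, $\mathbf{G3CN}$, $\mathbf{G3R}$, $\mathbf{G3K}$ respectively plus $L$-$D^*$. A derivation is a finite upward-growing tree of sequents whose leaves are initial sequents or conclusions of $L\bot$ and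 each other node is the conclusion of a rule instance whose premisses are its children. The height of a derivation is the length of its longest branch minus one. *)

(* Defs.v *)
From HB Require Import structures.
From Stdlib Require List.
From mathcomp Require Import all_boot.
From mathcomp Require Export finmap multiset.

Set Implicit Arguments.
Unset Strict Implicit.
Unset Printing Implicit Defensive.

Open Scope mset_scope.

Inductive form : Type :=
  | Var of nat
  | Bot
  | And of form & form
  | Or of form & form
  | Imp of form & form
  | Box of form.

(* A countable-type structure on formulas, required to form {mset form}. *)
Fixpoint form_encode (A : form) : GenTree.tree nat :=
  match A with
  | Var n => GenTree.Leaf n
  | Bot => GenTree.Node 0 [::]
  | And B C => GenTree.Node 1 [:: form_encode B; form_encode C]
  | Or B C => GenTree.Node 2 [:: form_encode B; form_encode C]
  | Imp B C => GenTree.Node 3 [:: form_encode B; form_encode C]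
  | Box B => GenTree.Node 4 [:: form_encode B]
  end.

Fixpoint form_decode (t : GenTree.tree nat) : form :=
  match t with
  | GenTree.Leaf n => Var n
  | GenTree.Node 1 [:: u; v] => And (form_decode u) (form_decode v)
  | GenTree.Node 2 [:: u; v] => Or (form_decode u) (form_decode v)
  | GenTree.Node 3 [:: u; v] => Imp (form_decode u) (form_decode v)
  | GenTree.Node 4 [:: u] => Box (form_decode u)
  | _ => Bot
  end.

Lemma form_encodeK : cancel form_encode form_decode.
Proof. by elim=> //= [B -> C ->|B -> C ->|B -> C ->|B ->]. Qed.

HB.instance Definition _ := Countable.copy form (can_type form_encodeK).

Record sequent : Type := Sequent { ant : {mset form}; suc : {mset form} }.

Notation "G ⇒ D" := (Sequent G D) (at level 70, no associativity).

Implicit Types (A B : form) (G D P Q : {mset form}).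

Definition boxes (P : {mset form}) : {mset form} :=
  seq_mset [seq Box A | A <- P].

(* Rules are relations between the list of premisses and the conclusion;
   initial sequents and L-bot are the rules with no premiss.  Multisets are
   unordered, so A +` D in a succedent is the multiset written D, A. *)
Inductive cp_rule : seq sequent -> sequent -> Prop :=
  | Ax p G D : cp_rule [::] (Var p +` G ⇒ Var p +` D)
  | LBot G D : cp_rule [::] (Bot +` G ⇒ D)
  | LAnd A B G D :
      cp_rule [:: A +` (B +` G) ⇒ D] (And A B +` G ⇒ D)
  | RAnd A B G D :
      cp_rule [:: G ⇒ A +` D; G ⇒ B +` D] (G ⇒ And A B +` D)
  | LOr A B G D :
      cp_rule [:: A +` G ⇒ D; B +` G ⇒ D] (Or A B +` G ⇒ D)
  | ROr A B G D :
      cp_rule [:: G ⇒ A +` (B +` D)] (G ⇒ Or A B +` D)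
  | LImp A B G D :
      cp_rule [:: G ⇒ A +` D; B +` G ⇒ D] (Imp A B +` G ⇒ D)
  | RImp A B G D :
      cp_rule [:: A +` G ⇒ B +` D] (G ⇒ Imp A B +` D).

Inductive modal_name : Set :=
  | LR_E | LR_M | LR_R | LR_C | LR_K | R_N
  | L_Dbot | L_DdiaE | L_DdiaM | L_DdiaC | L_Dstar.

(* Where a rule has one premiss per formula of a multiset, the premisses are
   listed along the enumeration of that multiset, with repetitions.  P and Q may be
   empty except in LR-C. *)
Inductive modal_rule : modal_name -> seq sequent -> sequent -> Prop :=
  | LR_E_rule A B G D :
      modal_rule LR_E
        [:: [mset A] ⇒ [mset B]; [mset B] ⇒ [mset A]]
        (Box A +` G ⇒ Box B +` D)
  | LR_M_rule A B G D :
      modal_rule LR_M [:: [mset A] ⇒ [mset B]] (Box A +` G ⇒ Box B +` D)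
  | LR_R_rule A P B G D :
      modal_rule LR_R
        [:: A +` P ⇒ [mset B]]
        (Box A +` (boxes P `+` G) ⇒ Box B +` D)
  | LR_C_rule P B G D :
      P != mset0 ->
      modal_rule LR_C
        ((P ⇒ [mset B]) :: [seq [mset B] ⇒ [mset A] | A <- P])
        (boxes P `+` G ⇒ Box B +` D)
  | LR_K_rule P B G D :
      modal_rule LR_K [:: P ⇒ [mset B]] (boxes P `+` G ⇒ Box B +` D)
  | R_N_rule B G D :
      modal_rule R_N [:: mset0 ⇒ [mset B]] (G ⇒ Box B +` D)
  | L_Dbot_rule A G D :
      modal_rule L_Dbot [:: [mset A] ⇒ mset0] (Box A +` G ⇒ D)
  | L_DdiaE_rule P G D :
      size P <= 2 ->
      modal_rule L_DdiaE [:: P ⇒ mset0; mset0 ⇒ P] (boxes P `+` G ⇒ D)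
  | L_DdiaM_rule P G D :
      size P <= 2 ->
      modal_rule L_DdiaM [:: P ⇒ mset0] (boxes P `+` G ⇒ D)
  | L_DdiaC_rule P Q G D :
      modal_rule L_DdiaC
        ((P `+` Q ⇒ mset0) :: [seq mset0 ⇒ [mset A; B] | A <- P, B <- Q])
        (boxes P `+` (boxes Q `+` G) ⇒ D)
  | L_Dstar_rule P G D :
      modal_rule L_Dstar [:: P ⇒ mset0] (boxes P `+` G ⇒ D).

Inductive calculus : Set :=
  | G3E | G3EN | G3M | G3MN | G3C | G3CN | G3R | G3K
  | G3EDbot | G3ENDbot | G3EDdia | G3ED | G3END
  | G3MDbot | G3MNDbot | G3MD | G3MND
  | G3CDdia | G3CD | G3CND | G3RD | G3KD.

Definition modal_rules (X : calculus) : seq modal_name :=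
  match X with
  | G3E => [:: LR_E]
  | G3EN => [:: LR_E; R_N]
  | G3M => [:: LR_M]
  | G3MN => [:: LR_M; R_N]
  | G3C => [:: LR_C]
  | G3CN => [:: LR_C; R_N]
  | G3R => [:: LR_R]
  | G3K => [:: LR_K]
  | G3EDbot => [:: LR_E; L_Dbot]
  | G3ENDbot => [:: LR_E; R_N; L_Dbot]
  | G3EDdia => [:: LR_E; L_DdiaE]
  | G3ED => [:: LR_E; L_Dbot; L_DdiaE]
  | G3END => [:: LR_E; R_N; L_Dbot; L_DdiaE]
  | G3MDbot => [:: LR_M; L_Dbot]
  | G3MNDbot => [:: LR_M; R_N; L_Dbot]
  | G3MD => [:: LR_M; L_DdiaM]
  | G3MND => [:: LR_M; R_N; L_DdiaM]
  | G3CDdia => [:: LR_C; L_DdiaC]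
  | G3CD => [:: LR_C; L_Dstar]
  | G3CND => [:: LR_C; R_N; L_Dstar]
  | G3RD => [:: LR_R; L_Dstar]
  | G3KD => [:: LR_K; L_Dstar]
  end.

Definition rule_of (X : calculus) (ps : seq sequent) (c : sequent) : Prop :=
  cp_rule ps c \/ exists r, List.In r (modal_rules X) /\ modal_rule r ps c.

Inductive tree : Type := Node of sequent & seq tree.

Definition endsequent (t : tree) : sequent := let: Node s _ := t in s.

Inductive derivation (X : calculus) : tree -> Prop :=
  | Derivation s ts :
      rule_of X [seq endsequent t | t <- ts] s ->
      (forall t, List.In t ts -> derivation X t) ->
      derivation X (Node s ts).

(* Number of nodes on a longest branch. *)
Fixpoint branch_length (t : tree) : nat :=
  let: Node _ ts := t in (foldr maxn 0 [seq branch_length u | u <- ts]).+1.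

Definition height (t : tree) : nat := (branch_length t).-1.

Definition derivable_with_height (X : calculus) (h : nat) (s : sequent) :=
  exists t : tree, [/\ derivation X t, endsequent t = s & height t = h].

Definition hp_admissible (X : calculus) (R : sequent -> sequent -> Prop) :=
  forall (prem concl : sequent) (h : nat),
    R prem concl -> derivable_with_height X h prem ->
    exists h', h' <= h /\ derivable_with_height X h' concl.

Inductive LC : sequent -> sequent -> Prop :=
  | LC_rule A G D : LC (A +` (A +` G) ⇒ D) (A +` G ⇒ D).

Inductive RC : sequent -> sequent -> Prop :=
  | RC_rule A G D : RC (G ⇒ A +` (A +` D)) (G ⇒ A +` D).

(* Main.v *)
(** Sequents form a commutative monoid under multiset union of both sides, and
    every rule instance has the form "principal part plus context".  All logical
    rules are height-preserving invertible, since in the modal rules only boxed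
    formulas are principal and the context is arbitrary.  Contraction is then
    proved by induction on the height, for all formulas and both sides at once.
    If at least one of the two copies lies in the context, it is dropped there,
    after inverting the premisses when the other copy is the principal formula of
    a logical rule.  If both copies are principal, the rule is modal, the copies
    are [Box A] on the left, and the induction hypothesis contracts the two
    copies of [A] in the premisses, which yields an instance of the same rule. *)

Require Import Defs.
From Stdlib Require List.
From mathcomp Require Import all_boot zify.

Set Implicit Arguments.
Unset Strict Implicit.
Unset Printing Implicit Defensive.

Local Open Scope mset_scope.

Implicit Types (A B F : form) (G D P R : {mset form}) (s c : sequent).

(** * Multiset decompositions and boxed multisets *)

Lemma mset1D_split (K : choiceType) (a : K) (M P Q : {mset K}) :
  a +` M = P `+` Q ->
  (exists2 P', P = a +` P' & M = P' `+` Q) \/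
  (exists2 Q', Q = a +` Q' & M = P `+` Q').
Proof.
move=> E; have : a \in P `+` Q by rewrite -E mset1D1.
have cancel N : a +` M = a +` N -> M = N.
  by move=> /(congr1 (msetB^~ [mset a])); rewrite !msetD1K.
move=> /msetDP[aP|aQ]; [left; exists (P `\ a)|right; exists (Q `\ a)];
  rewrite ?msetB1K //; apply: cancel; rewrite E.
  by rewrite msetDA msetB1K.
by rewrite msetDCA msetB1K.
Qed.

Lemma size_msetD (K : choiceType) (P Q : {mset K}) :
  size (P `+` Q) = size P + size Q.
Proof.
rewrite -size_cat; apply: perm_size; apply/allP => a _ /=.
by rewrite count_cat !count_mem_mset msetE2.
Qed.

Lemma size_mset1 (K : choiceType) (a : K) : size [mset a] = 1.
Proof. by rewrite enum_msetn. Qed.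

Lemma boxesE P A : boxes P (Box A) = P A.
Proof.
rewrite mset_seqE count_map -count_mem_mset; apply: eq_count => B /=.
by apply/eqP/eqP => [[]|->].
Qed.

Lemma boxesP P F : F \in boxes P -> exists A, F = Box A.
Proof.
rewrite in_mset mset_seqE -has_count has_map => /hasP[A _ /= /eqP <-].
by exists A.
Qed.

Lemma boxes0 : boxes mset0 = mset0.
Proof.
by rewrite /boxes enum_mset0; apply/msetP => F; rewrite mset_seqE mset0E.
Qed.

Lemma boxesD P Q : boxes (P `+` Q) = boxes P `+` boxes Q.
Proof.
apply/msetP => F; rewrite msetE2 !mset_seqE !count_map.
have /permP -> : perm_eq (P `+` Q) (P ++ Q).
  by apply/allP => a _ /=; rewrite count_cat !count_mem_mset msetE2.
by rewrite count_cat.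
Qed.

Lemma boxes1 A : boxes [mset A] = [mset Box A].
Proof.
rewrite /boxes enum_msetn /= mset_cons; apply/msetP => F.
by rewrite msetE2 mset_seqE addn0.
Qed.

(** Since [Box] is injective, every multiset of boxed formulas determines its unboxed form, so an
    occurrence can be removed on both levels at once. *)
Lemma boxes_split F M P :
  boxes P = F +` M -> exists A P', [/\ F = Box A, P = A +` P' & M = boxes P'].
Proof.
move=> E; have [A FA] : exists A, F = Box A.
  by apply: (@boxesP P); rewrite E mset1D1.
subst F; exists A, (P `\ A).
have AP : A \in P by rewrite in_mset -boxesE E mset1DE eqxx.
split; rewrite ?msetB1K //.
move: E; rewrite -{1}(msetB1K AP) boxesD boxes1.
by move=> /(congr1 (msetB^~ [mset Box A])); rewrite !msetD1K.
Qed.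

(** * The monoid of sequents and its one-formula generators *)

Definition adds (s t : sequent) : sequent :=
  ant s `+` ant t ⇒ suc s `+` suc t.

Local Notation "s ⊕ t" := (adds s t) (at level 55, right associativity).

Lemma addsA s t u : s ⊕ (t ⊕ u) = (s ⊕ t) ⊕ u.
Proof. by rewrite /adds /= !msetDA. Qed.

Lemma addsCA s t u : s ⊕ (t ⊕ u) = t ⊕ (s ⊕ u).
Proof. by rewrite /adds /= msetDCA (msetDCA (suc s)). Qed.

Lemma add0s s : (mset0 ⇒ mset0) ⊕ s = s.
Proof. by case: s => G D; rewrite /adds /= !mset0D. Qed.

(** The Boolean marks the side, [true] being the antecedent, so that a single argument covers left
    and right contraction. *)
Definition signed (b : bool) (F : form) : sequent :=
  if b then [mset F] ⇒ mset0 else mset0 ⇒ [mset F].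

(** The basic case distinction: with [c] the principal part and [t] the context of a rule instance,
    a chosen occurrence is located in one or the other. *)
Lemma signed_split b F s c t :
  signed b F ⊕ s = c ⊕ t ->
  (exists2 c', c = signed b F ⊕ c' & s = c' ⊕ t) \/
  (exists2 t', t = signed b F ⊕ t' & s = c ⊕ t').
Proof.
case: s c t b => [G D] [G1 D1] [G2 D2] [] []; rewrite !mset0D.
- move=> /mset1D_split[] [H -> ->] ->;
  [left; exists (H ⇒ D1)|right; exists (H ⇒ D2)]; by rewrite /adds /= ?mset0D.
- move=> -> /mset1D_split[] [H -> ->];
  [left; exists (G1 ⇒ H)|right; exists (G2 ⇒ H)]; by rewrite /adds /= ?mset0D.
Qed.

(** One-formula sequents are indecomposable. Hence an occurrence found in the principal part of a
    logical rule is the principal formula, with nothing left over. *)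
Lemma signed_inj b F b' F' c :
  signed b F = signed b' F' ⊕ c ->
  [/\ b = b', F = F' & c = (mset0 ⇒ mset0)].
Proof.
have mset1_inj (M : {mset form}) A B : [mset A] = B +` M -> A = B /\ M = mset0.
  move=> E; have := mset1D1 B M; rewrite -E in_mset1 => /eqP BA; subst B.
  by split=> //; rewrite -(msetD1K A M) -E msetBxx.
have mset0N (M : {mset form}) B : mset0 = B +` M -> False.
  by move=> E; have := mset1D1 B M; rewrite -E in_mset0.
by case: b b' c => [] [] [G D] []; rewrite !mset0D ?msetD0;
  do ?[by move=> /mset0N | by move=> _ /mset0N];
  [move=> /mset1_inj[-> ->] <- | move=> <- /mset1_inj[-> ->]].
Qed.

(** * Logical rules and closure under contraction *)

(** The active formulas of the premisses, stripped of the context. A function suffices because a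
    formula on a given side is principal in at most one logical rule. [Some [::]] is the
    zero-premiss rule for [Bot], whereas [None] says that there is no such rule. *)
Definition logical_premises (b : bool) (F : form) : option (seq sequent) :=
  match b, F with
  | true, Bot => Some [::]
  | true, And A B => Some [:: A +` [mset B] ⇒ mset0]
  | false, And A B => Some [:: mset0 ⇒ [mset A]; mset0 ⇒ [mset B]]
  | true, Or A B => Some [:: [mset A] ⇒ mset0; [mset B] ⇒ mset0]
  | false, Or A B => Some [:: mset0 ⇒ A +` [mset B]]
  | true, Imp A B => Some [:: mset0 ⇒ [mset A]; [mset B] ⇒ mset0]
  | false, Imp A B => Some [:: [mset A] ⇒ [mset B]]
  | _, _ => None
  end.

Definition initial (p : nat) : sequent := [mset Var p] ⇒ [mset Var p].

Lemma cp_rule_logical b F qs t :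
  logical_premises b F = Some qs ->
  cp_rule [seq q ⊕ t | q <- qs] (signed b F ⊕ t).
Proof.
case: t b F => G D [] [] //= > [<-]; rewrite /adds /= ?mset0D -?msetDA.
- exact: LBot.
- exact: LAnd.
- exact: LOr.
- exact: LImp.
- exact: RAnd.
- exact: ROr.
- exact: RImp.
Qed.

(** Abstract in [Q] so that modal rules can be analysed before derivability is introduced; [Q] later
    becomes [der X n], the induction hypothesis. *)
Definition contraction_closed (Q : sequent -> Prop) :=
  forall b F s, Q (signed b F ⊕ signed b F ⊕ s) -> Q (signed b F ⊕ s).

Lemma contraction_closedL Q A G D :
  contraction_closed Q -> Q (A +` (A +` G) ⇒ D) -> Q (A +` G ⇒ D).
Proof. by move=> /(_ true A (G ⇒ D)); rewrite /adds /= !mset0D. Qed.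

Lemma contraction_closedR Q A G D :
  contraction_closed Q -> Q (G ⇒ A +` (A +` D)) -> Q (G ⇒ A +` D).
Proof. by move=> /(_ false A (G ⇒ D)); rewrite /adds /= !mset0D. Qed.

Lemma sequent_ind (P : sequent -> Prop) :
  P (mset0 ⇒ mset0) ->
  (forall b F c, P c -> P (signed b F ⊕ c)) ->
  forall c, P c.
Proof.
have nilE : seq_mset [::] = mset0 :> {mset form}.
  by apply/msetP => F; rewrite mset_seqE mset0E.
move=> P0 PS [L R]; rewrite -(seq_mset_id L) -(seq_mset_id R).
elim: (enum_mset L) => [|A l IH].
  elim: (enum_mset R) => [|A l IH]; rewrite nilE ?mset_cons // -?nilE.
  by have := PS false A _ IH; rewrite /adds /= !mset0D nilE.
by have := PS true A _ IH; rewrite /adds /= !mset0D mset_cons.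
Qed.

(** Contracts the formulas of [c] one at a time. This is needed because inversion doubles all active
    formulas of a premiss together. *)
Lemma contraction_closed_adds Q c s :
  contraction_closed Q -> Q (c ⊕ c ⊕ s) -> Q (c ⊕ s).
Proof.
move=> cQ; elim/sequent_ind: c s => [|b F c IH] s; first by rewrite !add0s.
rewrite -!addsA (addsCA c (signed b F)) => /cQ.
by rewrite !(addsCA (signed b F) c) => /IH.
Qed.

(** * Families of premisses, and modal rules in schematic form *)

Definition all_premises (Q : sequent -> Prop) (ps : seq sequent) :=
  forall p, List.In p ps -> Q p.

Lemma all_premises_cons Q p ps :
  all_premises Q (p :: ps) <-> Q p /\ all_premises Q ps.
Proof.
split=> [H|[Hp Hps] q /= [<-|/Hps] //].
by split=> [|q qps]; apply: H; [left|right].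
Qed.

Lemma all_premises1 Q p : all_premises Q [:: p] <-> Q p.
Proof. by split=> [/all_premises_cons[]|Hp q [<-|]]. Qed.

Lemma all_premises_map (T : eqType) Q (f : T -> sequent) (l : seq T) :
  all_premises Q [seq f x | x <- l] <-> (forall x, x \in l -> Q (f x)).
Proof.
elim: l => [|x l IH] /=; first by split=> // _ p [].
rewrite all_premises_cons IH; split=> [[Hx Hl] y|H].
  by rewrite inE => /predU1P[->|/Hl].
by split=> [|y yl]; apply: H; rewrite inE ?eqxx // yl orbT.
Qed.

Lemma all_premises_adds Q qs t :
  all_premises Q [seq q ⊕ t | q <- qs] <->
  all_premises (fun q => Q (q ⊕ t)) qs.
Proof.
elim: qs => [|q qs IH] /=; first by split=> _ p [].
by rewrite !all_premises_cons IH.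
Qed.

Lemma all_premises_allpairs (T U : eqType) Q (f : T -> U -> sequent) l m :
  all_premises Q [seq f x y | x <- l, y <- m] <->
  (forall x y, x \in l -> y \in m -> Q (f x y)).
Proof.
elim: l => [|x l IH] /=; first by split=> // _ p [].
have cat ps qs :
    all_premises Q (ps ++ qs) <-> all_premises Q ps /\ all_premises Q qs.
  split=> [H|[H1 H2] p /List.in_app_iff[/H1|/H2] //].
  by split=> p Hp; apply: H; apply/List.in_app_iff; [left|right].
rewrite cat IH all_premises_map; split=> [[Hx Hl] y z|H].
  by rewrite inE => /predU1P[->|/Hl]; auto.
by split=> [y ym|y z yl zm]; apply: H; rewrite // inE ?eqxx // yl orbT.
Qed.

(* The context [t] of a modal rule is arbitrary and its principal formulas are
   boxed, at most one of them on the right; hence contracting two principal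
   occurrences always takes place on the left. *)
Record modal_schema (r : modal_name) (ps : seq sequent)
    (P R : {mset form}) : Prop := {
  schema_size : size R <= 1;
  schema_rule : forall t, modal_rule r ps ((boxes P ⇒ boxes R) ⊕ t);
  schema_contract : forall Q A P', contraction_closed Q ->
    P = A +` (A +` P') -> all_premises Q ps ->
    exists2 ps', all_premises Q ps' &
      forall t, modal_rule r ps' ((boxes (A +` P') ⇒ boxes R) ⊕ t) }.

(** Where the principal multiset forms a side of a premiss, closure of [Q] contracts it there; where
    it indexes a family of premisses, the contracted rule needs only a subfamily. With at most one
    principal box on the left, the contraction clause is vacuous. *)
Lemma modal_rule_schema r ps s :
  modal_rule r ps s ->
  exists P R t, modal_schema r ps P R /\ s = (boxes P ⇒ boxes R) ⊕ t.
Proof.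
have not_single A B P : [mset B] = A +` (A +` P) -> False.
  move/(congr1 (fun M : {mset form} => size M)).
  by rewrite !size_msetD !size_mset1.
have not_empty A P : mset0 = A +` (A +` P) -> False.
  move/(congr1 (fun M : {mset form} => size M)).
  by rewrite !size_msetD !size_mset1 size_mset0.
case.
- move=> A B G D; exists [mset A], [mset B], (G ⇒ D).
  split; last by rewrite !boxes1.
  split=> [|t|Q A' P' _ /not_single []]; first by rewrite size_mset1.
  by rewrite !boxes1; constructor.
- move=> A B G D; exists [mset A], [mset B], (G ⇒ D).
  split; last by rewrite !boxes1.
  split=> [|t|Q A' P' _ /not_single []]; first by rewrite size_mset1.
  by rewrite !boxes1; constructor.
- move=> A P B G D; exists (A +` P), [mset B], (G ⇒ D).
  have E C M t : (boxes (C +` M) ⇒ boxes [mset B]) ⊕ t =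
      (Box C +` (boxes M `+` ant t) ⇒ Box B +` suc t).
    by rewrite /adds /= boxesD !boxes1 -msetDA.
  split; last by rewrite E.
  split=> [|t|Q A' P' cQ -> /all_premises1 H]; first by rewrite size_mset1.
    by rewrite E; constructor.
  exists [:: A' +` P' ⇒ [mset B]] => [|t]; last by rewrite E; constructor.
  by apply/all_premises1; apply: contraction_closedL H.
- move=> P B G D P0; exists P, [mset B], (G ⇒ D).
  split; last by rewrite boxes1.
  split=> [|t|Q A' P' cQ EP]; first by rewrite size_mset1.
    by rewrite boxes1; constructor.
  rewrite EP => /all_premises_cons[H1 /all_premises_map H2].
  exists ((A' +` P' ⇒ [mset B]) :: [seq [mset B] ⇒ [mset A] | A <- A' +` P']).
    apply/all_premises_cons; split; first exact: contraction_closedL H1.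
    (* Every element of the contracted multiset already belongs to [P], so its converse premiss is
       among the given ones. *)
    by apply/all_premises_map => C CP; apply: H2; apply: mset1Dr.
  move=> t; rewrite boxes1; constructor.
  by apply/eqP => E0; have := mset1D1 A' P'; rewrite E0 in_mset0.
- move=> P B G D; exists P, [mset B], (G ⇒ D).
  split; last by rewrite boxes1.
  split=> [|t|Q A' P' cQ -> /all_premises1 H]; first by rewrite size_mset1.
    by rewrite boxes1; constructor.
  exists [:: A' +` P' ⇒ [mset B]] => [|t]; last by rewrite boxes1; constructor.
  by apply/all_premises1; apply: contraction_closedL H.
- move=> B G D; exists mset0, [mset B], (G ⇒ D).
  split; last by rewrite boxes1 boxes0 /adds /= mset0D.
  split=> [|t|Q A' P' _ /not_empty []]; first by rewrite size_mset1.
  by rewrite boxes1 boxes0 /adds /= mset0D; constructor.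
- move=> A G D; exists [mset A], mset0, (G ⇒ D).
  split; last by rewrite boxes1 boxes0 /adds /= mset0D.
  split=> [|t|Q A' P' _ /not_single []]; first by rewrite size_mset0.
  by rewrite boxes1 boxes0 /adds /= mset0D; constructor.
- move=> P G D P2; exists P, mset0, (G ⇒ D).
  split; last by rewrite boxes0 /adds /= mset0D.
  split=> [|t|Q A' P' cQ EP]; first by rewrite size_mset0.
    by rewrite boxes0 /adds /= mset0D; constructor.
  rewrite EP => /all_premises_cons[H1 /all_premises1 H2].
  exists [:: A' +` P' ⇒ mset0; mset0 ⇒ A' +` P'] => [|t].
    apply/all_premises_cons; split; first exact: contraction_closedL H1.
    by apply/all_premises1; apply: contraction_closedR H2.
  rewrite boxes0 /adds /= mset0D; constructor.
  by move: P2; rewrite EP !size_msetD; lia.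
- move=> P G D P2; exists P, mset0, (G ⇒ D).
  split; last by rewrite boxes0 /adds /= mset0D.
  split=> [|t|Q A' P' cQ EP]; first by rewrite size_mset0.
    by rewrite boxes0 /adds /= mset0D; constructor.
  rewrite EP => /all_premises1 H.
  exists [:: A' +` P' ⇒ mset0] => [|t].
    by apply/all_premises1; apply: contraction_closedL H.
  rewrite boxes0 /adds /= mset0D; constructor.
  by move: P2; rewrite EP !size_msetD; lia.
- move=> P1 P2 G D; exists (P1 `+` P2), mset0, (G ⇒ D).
  have E M N t : (boxes (M `+` N) ⇒ boxes mset0) ⊕ t =
      (boxes M `+` (boxes N `+` ant t) ⇒ suc t).
    by rewrite /adds /= boxes0 mset0D boxesD msetDA.
  split; last by rewrite E.
  split=> [|t|Q A P' cQ EP]; first by rewrite size_mset0.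
    by rewrite E; constructor.
  move=> /all_premises_cons[H1 /all_premises_allpairs H2].
  (* Dropping one copy of [A] from either half leaves a subfamily of the
     premisses, also when the two copies lie in different halves. *)
  have [N1 [N2 [EN sub1 sub2]]] : exists N1 N2, [/\ A +` P' = N1 `+` N2,
      {subset N1 <= P1} & {subset N2 <= P2}].
    case: (mset1D_split (esym EP)) => [] [N -> ->]; [exists N, P2|exists P1, N];
      by split=> // C CN; apply: mset1Dr.
  exists ((N1 `+` N2 ⇒ mset0) :: [seq mset0 ⇒ [mset B; C] | B <- N1, C <- N2]).
    apply/all_premises_cons; split.
      by rewrite -EN; apply: contraction_closedL; rewrite // -EP.
    by apply/all_premises_allpairs => B C /sub1 BP /sub2 CP; apply: H2.
  by move=> t; rewrite EN E; constructor.
- move=> P G D; exists P, mset0, (G ⇒ D).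
  split; last by rewrite boxes0 /adds /= mset0D.
  split=> [|t|Q A' P' cQ -> /all_premises1 H]; first by rewrite size_mset0.
    by rewrite boxes0 /adds /= mset0D; constructor.
  exists [:: A' +` P' ⇒ mset0] => [|t].
    by apply/all_premises1; apply: contraction_closedL H.
  by rewrite boxes0 /adds /= mset0D; constructor.
Qed.

(** * A three-case view of the rules, and bounded derivability *)

(** Makes the split into principal part and context [t] explicit, so that inversion and contraction
    need three cases rather than one per rule. *)
Variant rule_view (X : calculus) : seq sequent -> sequent -> Prop :=
  | ViewInitial p t : rule_view X [::] (initial p ⊕ t)
  | ViewLogical b F qs t :
      logical_premises b F = Some qs ->
      rule_view X [seq q ⊕ t | q <- qs] (signed b F ⊕ t)
  | ViewModal r ps P R t :
      List.In r (modal_rules X) -> modal_schema r ps P R ->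
      rule_view X ps ((boxes P ⇒ boxes R) ⊕ t).

Lemma rule_of_view X ps s : rule_of X ps s -> rule_view X ps s.
Proof.
case=> [|[r [rX /modal_rule_schema[P [R [t [H ->]]]]]]];
  last exact: ViewModal rX H.
have view b F qs G D (E : logical_premises b F = Some qs) :=
  @ViewLogical X b F qs (G ⇒ D) E.
case=> [p G D|G D|A B G D|A B G D|A B G D|A B G D|A B G D|A B G D].
- exact: (ViewInitial X p (G ⇒ D)).
- by have := view true Bot _ G D erefl; rewrite /adds /= !mset0D.
- have := view true (And A B) _ G D erefl.
  by rewrite /adds /= !mset0D -!msetDA.
- by have := view false (And A B) _ G D erefl; rewrite /adds /= !mset0D.
- by have := view true (Or A B) _ G D erefl; rewrite /adds /= !mset0D.
- have := view false (Or A B) _ G D erefl.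
  by rewrite /adds /= !mset0D -!msetDA.
- by have := view true (Imp A B) _ G D erefl; rewrite /adds /= !mset0D.
- by have := view false (Imp A B) _ G D erefl; rewrite /adds /= !mset0D.
Qed.

(* Derivable with a derivation whose branches have at most [n] nodes, so that
   [der X h.+1] bounds the height by [h]. *)
Fixpoint der (X : calculus) (n : nat) (s : sequent) : Prop :=
  if n is m.+1 then exists2 ps, rule_of X ps s & all_premises (der X m) ps
  else False.

Lemma derS X n s : der X n s -> der X n.+1 s.
Proof.
elim: n s => //= n IH s [ps rs H]; exists ps => // p /H; exact: IH.
Qed.

Lemma der_initial X n p t : der X n.+1 (initial p ⊕ t).
Proof. by exists [::] => //; left; apply: Ax. Qed.

Lemma der_logical X n b F qs t :
  logical_premises b F = Some qs ->
  all_premises (fun q => der X n (q ⊕ t)) qs -> der X n.+1 (signed b F ⊕ t).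
Proof.
move=> E H; exists [seq q ⊕ t | q <- qs]; last exact/all_premises_adds.
by left; apply: cp_rule_logical.
Qed.

Lemma der_modal X n r ps s :
  List.In r (modal_rules X) -> modal_rule r ps s ->
  all_premises (der X n) ps -> der X n.+1 s.
Proof. by move=> rX rs H; exists ps => //; right; exists r. Qed.

(** * Height-preserving inversion and contraction *)

Lemma boxes_not_logical b F c P R :
  (boxes P ⇒ boxes R) = signed b F ⊕ c -> logical_premises b F = None.
Proof.
case: b => -[]; rewrite ?mset0D => E1 E2.
  by have [A [_ [-> _ _]]] := boxes_split E1.
by have [A [_ [-> _ _]]] := boxes_split E2.
Qed.

Lemma initial_signed b F c p :
  initial p = signed b F ⊕ c -> F = Var p.
Proof.
case: b => -[]; rewrite ?mset0D => E1 E2.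
  by have := mset1D1 F (ant c); rewrite -E1 in_mset1 => /eqP.
by have := mset1D1 F (suc c); rewrite -E2 in_mset1 => /eqP.
Qed.

(** If the formula is principal, the desired sequent is a premiss. In the context of a logical rule
    it is inverted in the premisses. In the context of an initial sequent or modal rule it is
    replaced outright, since that context is arbitrary. *)
Lemma logical_inversion X n b F qs q s :
  logical_premises b F = Some qs -> List.In q qs ->
  der X n (signed b F ⊕ s) -> der X n (q ⊕ s).
Proof.
move=> Fqs qqs; elim: n s => [//|n IH] s [ps /rule_of_view].
move def_s : (signed b F ⊕ s) => s0 rv.
case: rv def_s => [p t|b0 F0 qs0 t F0qs|r {}ps P R t rX sch] def_s H.
- case: (signed_split def_s) => [] [u].
    by move=> /initial_signed FV; move: Fqs; rewrite FV; case: (b).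
  by move=> _ ->; rewrite addsCA; apply: der_initial.
- move: H => /all_premises_adds H; case: (signed_split def_s) => [] [u].
    move=> /signed_inj[bE FE ->].
    move: F0qs; rewrite bE FE Fqs => -[qsE] ->.
    by rewrite add0s; apply/derS/H; rewrite -qsE.
  move=> tE ->; rewrite addsCA; apply: der_logical F0qs _ => q0 q0qs.
  by rewrite -addsCA; apply: IH; rewrite addsCA -tE; apply: H.
- case: (signed_split def_s) => [] [u].
    by move=> /boxes_not_logical; rewrite Fqs.
  by move=> _ ->; rewrite addsCA; apply: der_modal rX (schema_rule sch _) H.
Qed.

Lemma der_contraction X n : contraction_closed (der X n).
Proof.
elim: n => [//|n IH] b F s.
(* One copy is principal and the other sits in the context of each premiss. Inverting the latter at
   the same bound [n] yields [q ⊕ q ⊕ t]; contracting [q] and reapplying the rule gives the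
   conclusion. *)
have principal qs t : logical_premises b F = Some qs ->
    all_premises (fun q => der X n (q ⊕ signed b F ⊕ t)) qs ->
    der X n.+1 (signed b F ⊕ t).
  move=> Fqs H; apply: der_logical (Fqs) _ => q qqs.
  apply: contraction_closed_adds => //.
  by apply: logical_inversion Fqs (qqs) _; rewrite addsCA; apply: H.
case=> ps /rule_of_view.
move def_s : (signed b F ⊕ signed b F ⊕ s) => s0 rv.
case: rv def_s => [p t|b0 F0 qs t F0qs|r {}ps P R t rX sch] def_s H.
- case: (signed_split def_s) => [] [u].
    move=> cE; move: (cE) => /initial_signed FV.
    case/signed_split=> [] [v]; last first.
      by move=> _ ->; rewrite addsA -cE; apply: der_initial.
    (* Both copies cannot lie in the principal part: [initial p] has a single formula on each
       side. *)
    move=> uE; move: cE; rewrite uE {}FV; case: (b) => -[].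
      move/(congr1 (fun M : {mset form} => size M)).
      by rewrite !size_msetD !size_mset1.
    move=> _ /(congr1 (fun M : {mset form} => size M)).
    by rewrite !size_msetD !size_mset1; lia.
  by move=> _ ->; apply: der_initial.
- move: H => /all_premises_adds H; case: (signed_split def_s) => [] [u].
    move=> /signed_inj[bE FE ->]; rewrite add0s => tE; subst b0 F0 t.
    exact: principal F0qs H.
  move=> tE; subst t => /signed_split[] [v].
    move=> /signed_inj[bE FE ->]; rewrite add0s => sE; subst b0 F0 s.
    exact: principal F0qs H.
  move=> uE ->; rewrite addsCA; apply: der_logical F0qs _ => q qqs.
  by rewrite addsCA; apply: IH; rewrite -2!(addsCA q) -uE; apply: H.
- case: (signed_split def_s) => [] [u]; last first.
    by move=> _ ->; apply: der_modal rX (schema_rule sch _) H.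
  move=> cE /signed_split[] [v]; last first.
    by move=> _ ->; rewrite addsA -cE; apply: der_modal rX (schema_rule sch _) H.
  (* Both copies are principal in the modal rule. On the left they come from two copies of [A] in
     [P], which [schema_contract] merges using [IH]; on the right they contradict the bound of one
     on the size of [R]. *)
  move=> uE ->; move: cE; rewrite uE; case: (b) => -[].
    rewrite !mset0D => /boxes_split[A [P1 [-> P1E]]].
    move=> /esym /boxes_split[A' [P2 [[<-] P2E vE]]] RE.
    subst P1; case: (schema_contract sch IH P1E H) => ps' H' rule'.
    apply: der_modal rX _ H'; rewrite addsA; move: (rule' t).
    by rewrite boxesD boxes1 RE /adds /= vE !mset0D.
  move=> _ /boxes_split[A [R1 [_ R1E]]] /esym /boxes_split[A' [R2 [_ R2E _]]].
  by have := schema_size sch; rewrite R1E R2E !size_msetD !size_mset1.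
Qed.

(** * Passage between derivation trees and bounded derivability *)

(** The induction runs on the bound instead of the tree, whose subtrees are nested in a list. *)
Lemma derivation_der X n (t : tree) :
  derivation X t -> branch_length t <= n -> der X n (endsequent t).
Proof.
elim: n t => [|n IH] _ [s ts rs Hts] //=; rewrite ltnS => bts.
exists [seq endsequent t | t <- ts] => // {rs}.
elim: ts Hts bts => [|t ts IHts] Hts /=; first by move=> _ p [].
rewrite geq_max => /andP[bt bts]; apply/all_premises_cons; split.
  by apply: IH bt; apply: Hts; left.
by apply: IHts => // u uts; apply: Hts; right.
Qed.

Lemma der_derivable X n s :
  der X n s ->
  exists t : tree,
    [/\ derivation X t, endsequent t = s & branch_length t <= n].
Proof.
elim: n s => [//|n IH] s [ps rs H].
have [ts [Hts tsE bts]] : exists ts,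
  [/\ forall t, List.In t ts -> derivation X t,
    [seq endsequent t | t <- ts] = ps &
    foldr maxn 0 [seq branch_length t | t <- ts] <= n].
  elim: ps H {rs} => [|p ps IHps]; first by exists [::]; split.
  move=> /all_premises_cons[/IH[t [dt tp bt]] /IHps[ts [dts tsps bts]]].
  exists (t :: ts); split=> [u /= [<-|/dts] //||] /=; first by rewrite tp tsps.
  by rewrite geq_max bt.
by exists (Node s ts); split=> //; constructor=> //; rewrite tsE.
Qed.

Theorem theorem3 (X : calculus) : hp_admissible X LC /\ hp_admissible X RC.
Proof.
(* A branch always has at least one node, so height [h] means exactly [h.+1] nodes on a longest
   branch. *)
have start h s : derivable_with_height X h s -> der X h.+1 s.
  case=> t [dt <- <-]; apply: derivation_der => //.
  by rewrite /height; case: (t).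
have conclude h s : der X h.+1 s ->
    exists h', h' <= h /\ derivable_with_height X h' s.
  move=> /der_derivable[t [dt ts bt]]; exists (height t); split; last by exists t.
  by rewrite /height -ltnS; case: (t) bt.
split=> prem concl h [A G D] /start H; apply: conclude.
- exact: contraction_closedL (@der_contraction _ _) H.
- exact: contraction_closedR (@der_contraction _ _) H.
Qed.
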